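(* Let a prior network with boundary conditions, positive weights $d_{kl}$ and a material amount $K>0$ be given. Let $(\kappa_{kl})$ be a physical network with $\sum_{k>l,\langle k,l\rangle=1}\kappa_{kl}^{1/2}d_{kl}=K$ that globally minimizes the complementary dissipation $$f=\sum_{k>l,\langle k,l\rangle=1}\frac{Q_{kl}^2}{\kappa_{kl}}-2\sum_{k\in\mathcal P}\bar p_k\sum_{l:\langle k,l\rangle=1}Q_{kl}$$ among all physical networks satisfying this material constraint, where $Q_{kl}$ denotes the Kirchhoff flow of the network. Then there is exactly one path between any pair of vertices, except in the case that the network has no flow in it, i.e. $Q_{kl}=0$ for all $\langle k,l\rangle=1$.
   Context: Prior network: a finite simple undirected graph on vertices $1,\dots,V$; $\langle k,l\rangle=1$ means $k,l$ are joined by an edge ($\langle k,l\rangle=\langle l,k\rangle$), and $\langle k,l\rangle=0$ otherwise. Each edge carries a fixed weight $d_{kl}=d_{lk}>0$. Boundary conditions: disjoint vertex sets $\mathcal P$ (pressure vertices, each with prescribed pressure $\bar p_k\in\mathbb R$) and $\mathcal F$ (flow vertices, each with prescribed inflow $q_k\in\mathbb R$). Put $q_k=0$ for $k\notin\mathcal P\cup\mathcal F$. A network is a choice of conductances $\kappa_{kl}=\kappa_{lk}\ge 0$ on the edges. A Kirchhoff flow is $Q_{kl}=(p_k-p_l)\kappa_{kl}$ on the edges (so $Q_{kl}=-Q_{lk}$), where the pressures $p_k$ satisfy $p_k=\bar p_k$ for $k\in\mathcal P$ and $\sum_{l:\langle k,l\rangle=1}(p_k-p_l)\kappa_{kl}=q_k$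 for $k\notin\mathcal P$. The network is physical if there is exactly one Kirchhoff flow (equivalently, every connected component of the graph formed by all vertices and the edges with $\kappa_{kl}>0$ contains a vertex of $\mathcal P$ or has total prescribed inflow zero). Convention: a term $Q_{kl}^2/\kappa_{kl}$ with $\kappa_{kl}=0$ and $Q_{kl}=0$ is $0$. A path between vertices $k$ and $l$ is a sequence of pairwise distinct vertices $k=k_1,k_2,\dots,k_n=l$ with $\langle k_i,k_{i+1}\rangle=1$ and $\kappa_{k_ik_{i+1}}>0$ for all $1\le i\le n-1$.
   Formalization: ''Exactly one path between any pair of vertices'' is stated only for pairs in the same connected component of the network (edges with positive conductance), since an optimal network with flow may leave vertices disconnected, e.g. graph 1-2-3 with pressures 1, 0 at vertices 1, 2. *)

(* Defs.v *)
From mathcomp Require Import all_boot all_order all_algebra.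
From mathcomp Require Import reals.

Set Implicit Arguments.
Unset Strict Implicit.
Unset Printing Implicit Defensive.

Import Order.TTheory GRing.Theory Num.Theory.
Local Open Scope ring_scope.

Record prior_network (R : realType) (V : nat) := PriorNetwork {
  edge : rel 'I_V;
  weight : 'I_V -> 'I_V -> R;
  edge_sym : symmetric edge;
  edge_irr : irreflexive edge;
  weight_sym : forall k l, edge k l -> weight k l = weight l k;
  weight_gt0 : forall k l, edge k l -> 0 < weight k l }.

(* The values of [pbar] outside [pressure_set] and of [inflow] on             *)
(* [pressure_set] are never used.                                             *)
Record boundary (R : realType) (V : nat) := Boundary {
  pressure_set : {set 'I_V};
  flow_set : {set 'I_V};
  pbar : 'I_V -> R;
  inflow : 'I_V -> R;
  pressure_flow_disjoint : [disjoint pressure_set & flow_set];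
  inflow_eq0 : forall k, k \notin pressure_set :|: flow_set -> inflow k = 0 }.

Section Networks.
Variables (R : realType) (V : nat).
Variables (N : prior_network R V) (B : boundary R V).
Implicit Types kappa Q : 'M[R]_V.

(* Functions on the edges are matrices vanishing off the edges, so equality   *)
(* of matrices is equality of the functions on the edges.                     *)
Definition conductances kappa : Prop :=
  [/\ forall k l, kappa k l = kappa l k,
      forall k l, edge N k l -> 0 <= kappa k l
    & forall k l, ~~ edge N k l -> kappa k l = 0].

(* [Q] vanishes off the edges because [kappa] does. *)
Definition kirchhoff_flow kappa Q : Prop :=
  exists p : 'I_V -> R,
    [/\ forall k, k \in pressure_set B -> p k = pbar B k,
        forall k, k \notin pressure_set B ->
          \sum_(l < V | edge N k l) (p k - p l) * kappa k l = inflow B k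
      & forall k l, Q k l = (p k - p l) * kappa k l].

Definition physical kappa : Prop :=
  conductances kappa /\ exists! Q, kirchhoff_flow kappa Q.

Definition material kappa : R :=
  \sum_(k < V) \sum_(l < V | (l < k)%N && edge N k l)
    Num.sqrt (kappa k l) * weight N k l.

(* As [x / 0 = 0], a term with [kappa k l = 0] (hence [Q k l = 0]) is [0]. *)
Definition complementary_dissipation kappa Q : R :=
  \sum_(k < V) \sum_(l < V | (l < k)%N && edge N k l) Q k l ^+ 2 / kappa k l
  - 2 * \sum_(k in pressure_set B) pbar B k * \sum_(l < V | edge N k l) Q k l.

(* [Q] is the Kirchhoff flow of [kappa], unique since [kappa] is physical. *)
Definition global_minimizer (K : R) kappa Q : Prop :=
  [/\ physical kappa, material kappa = K, kirchhoff_flow kappa Q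
    & forall kappa' Q',
        physical kappa' -> material kappa' = K -> kirchhoff_flow kappa' Q' ->
        complementary_dissipation kappa Q
          <= complementary_dissipation kappa' Q'].

(* An optimal network may leave some vertices disconnected from each other    *)
(* (for instance, all the material goes to the edge 1-2 of the graph 1-2-3    *)
(* when only 1 and 2 are pressure vertices, with distinct pressures, and      *)
(* there is no flow vertex). Existence of a path is thus only meaningful for  *)
(* vertices in the same component, i.e. related by [connect (channel kappa)]. *)
Definition channel kappa : rel 'I_V :=
  [rel k l | edge N k l && (0 < kappa k l)].

(* The path is the vertex sequence [k :: s]. *)
Definition network_path kappa (k l : 'I_V) (s : seq 'I_V) : Prop :=
  [/\ path (channel kappa) k s, last k s = l & uniq (k :: s)].

End Networks.

(* Main.v *)
(* The Kirchhoff flow minimizes the complementary dissipation among all flows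
   that meet the inflow conditions and live on channels with positive
   conductance, and a network carrying such a flow is physical; hence an optimal
   pair (kappa, Q) is optimal among all such pairs. If Q is nonzero, it is
   nonzero on every channel. For a nonzero circulation sigma along channels, replace
   Q by Q + t sigma and kappa by kappa (1 + t sigma / Q)^2: the dissipation of
   each channel is unchanged, and as long as 1 + t sigma / Q >= 0 the material
   is affine in t. Choosing the sign of sigma so that the material does not grow
   and moving until a channel disappears saves the dissipation of that channel,
   a contradiction. Two distinct paths with the same ends would carry a nonzero
   circulation. *)
Require Import Defs.
From mathcomp Require Import all_boot all_order all_algebra.
From mathcomp Require Import reals.
From mathcomp Require Import ring lra.

Set Implicit Arguments.
Unset Strict Implicit.
Unset Printing Implicit Defensive.

Import Order.TTheory GRing.Theory Num.Theory.
Local Open Scope ring_scope.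

(** * Sums over unoriented edges and discrete integration by parts *)

Section EdgeSums.
Variables (R : realType) (V : nat) (N : prior_network R V).
Implicit Types G : 'I_V -> 'I_V -> R.

Definition edge_sum G : R :=
  \sum_(k < V) \sum_(l < V | (l < k)%N && edge N k l) G k l.

Lemma eq_edge_sum G G' :
  (forall k l, edge N k l -> G k l = G' k l) -> edge_sum G = edge_sum G'.
Proof.
by move=> eqG; apply: eq_bigr => k _; apply: eq_bigr => l /andP[_] /eqG.
Qed.

Lemma edge_sumD G G' :
  edge_sum (fun k l => G k l + G' k l) = edge_sum G + edge_sum G'.
Proof.
by rewrite /edge_sum -big_split; apply: eq_bigr => k _; rewrite big_split.
Qed.

Lemma edge_sumZ a G : edge_sum (fun k l => a * G k l) = a * edge_sum G.
Proof.
by rewrite /edge_sum mulr_sumr; apply: eq_bigr => k _; rewrite mulr_sumr.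
Qed.

Lemma edge_sum_ge0 G :
  (forall k l, edge N k l -> 0 <= G k l) -> 0 <= edge_sum G.
Proof.
by move=> G0; apply: sumr_ge0 => k _; apply: sumr_ge0 => l /andP[_] /G0.
Qed.

(** The sum meets each edge in one orientation only; symmetry of [G] carries the conclusion to the
    other. *)
Lemma edge_sum_eq0 G :
  (forall k l, G k l = G l k) -> (forall k l, edge N k l -> 0 <= G k l) ->
  edge_sum G = 0 -> forall k l, edge N k l -> G k l = 0.
Proof.
move=> symG G0 SG0.
have lower (k l : 'I_V) : (l < k)%N -> edge N k l -> G k l = 0.
  move=> lt_lk ekl.
  have row0 : \sum_(j < V | (j < k)%N && edge N k j) G k j = 0.
    apply: (psumr_eq0P _ SG0) => // i _.
    by apply: sumr_ge0 => j /andP[_] /G0.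
  apply: (psumr_eq0P _ row0) => [j /andP[_] /G0 //|].
  by rewrite lt_lk.
move=> k l ekl; case: (ltngtP l k) => [lt_lk|lt_kl|/val_inj eq_lk].
- exact: lower.
- by rewrite symG; apply: lower => //; rewrite edge_sym.
- by move: ekl; rewrite eq_lk edge_irr.
Qed.

Lemma edge_sum_gt0 G k l :
  (forall k l, G k l = G l k) -> (forall k l, edge N k l -> 0 <= G k l) ->
  edge N k l -> 0 < G k l -> 0 < edge_sum G.
Proof.
move=> symG G0 ekl Gkl; rewrite lt_def edge_sum_ge0 // andbT.
by apply/eqP => /(edge_sum_eq0 symG G0) /(_ k l ekl) Gkl0; rewrite Gkl0 ltxx in Gkl.
Qed.

Lemma sum_edge (k : 'I_V) (F : 'I_V -> R) :
  (forall l, ~~ edge N k l -> F l = 0) ->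
  \sum_(l < V | edge N k l) F l = \sum_l F l.
Proof.
move=> F0; rewrite big_mkcond; apply: eq_bigr => l _.
by case: ifPn => // /F0.
Qed.

(** Discrete Green identity: by antisymmetry an edge contributes [p k * D k l] to the divergence at
    [k] and [p l * D l k] to that at [l]. *)
Lemma edge_sum_by_parts (p : 'I_V -> R) (D : 'M[R]_V) :
  (forall k l, D k l = - D l k) -> (forall k l, ~~ edge N k l -> D k l = 0) ->
  edge_sum (fun k l => (p k - p l) * D k l) = \sum_k p k * \sum_l D k l.
Proof.
move=> antiD D0.
pose lower (G : 'I_V -> 'I_V -> R) := \sum_(k < V) \sum_(l < V | (l < k)%N) G k l.
have edgeE G : (forall k l, ~~ edge N k l -> G k l = 0) -> edge_sum G = lower G.
  move=> G0; apply: eq_bigr => k _; rewrite big_mkcondr.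
  by apply: eq_bigr => l _; case: ifPn => // /G0.
rewrite edgeE; last by move=> k l /D0 ->; rewrite mulr0.
have -> : \sum_k p k * \sum_l D k l =
    lower (fun k l => p k * D k l) + lower (fun k l => p l * D l k).
  rewrite [X in _ + X]/lower.
  under [X in _ + X]eq_bigr do rewrite big_mkcond.
  rewrite exchange_big -big_split; apply: eq_bigr => k _ /=.
  rewrite mulr_sumr [X in X + _]big_mkcond -big_split; apply: eq_bigr => l _ /=.
  case: (ltngtP l k) => [||/val_inj ->]; rewrite ?addr0 ?add0r //.
  by rewrite D0 ?edge_irr // mulr0.
rewrite -big_split; apply: eq_bigr => k _; rewrite -big_split.
by apply: eq_bigr => l _; rewrite /= (antiD l k); ring.
Qed.

End EdgeSums.

(** * Feasible flows, Kirchhoff flows and Thomson's principle *)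

Section Flows.
Variables (R : realType) (V : nat).
Variables (N : prior_network R V) (B : boundary R V).
Implicit Types kappa Q : 'M[R]_V.

(** No potential is required, so competitors can be built without solving for pressures. *)
Definition feasible_flow kappa Q : Prop :=
  [/\ forall k l, Q k l = - Q l k,
      forall k, k \notin pressure_set B -> \sum_l Q k l = inflow B k
    & forall k l, kappa k l = 0 -> Q k l = 0].

Definition dissipation kappa Q : R :=
  edge_sum N (fun k l => Q k l ^+ 2 / kappa k l).

Definition boundary_work Q : R :=
  2 * \sum_(k in pressure_set B) pbar B k * \sum_(l < V | edge N k l) Q k l.

Lemma complementary_dissipationE kappa Q :
  complementary_dissipation N B kappa Q = dissipation kappa Q - boundary_work Q.
Proof. by []. Qed.

Lemma conductances_ge0 kappa k l : conductances N kappa -> 0 <= kappa k l.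
Proof.
by case=> _ k0 k1; case: (boolP (edge N k l)) => [/k0|/k1 ->].
Qed.

Lemma dissipation_ge0 kappa Q : conductances N kappa -> 0 <= dissipation kappa Q.
Proof.
move=> ck; apply: edge_sum_ge0 => k l _.
by rewrite divr_ge0 ?sqr_ge0 ?conductances_ge0.
Qed.

Lemma material_ge0 kappa : 0 <= material N kappa.
Proof.
apply: edge_sum_ge0 => k l ekl.
by rewrite mulr_ge0 ?sqrtr_ge0 // ltW ?weight_gt0.
Qed.

Lemma materialZ c kappa :
  0 <= c -> material N (c ^+ 2 *: kappa) = c * material N kappa.
Proof.
move=> c0; rewrite /material -/(edge_sum N _) -/(edge_sum N _) -edge_sumZ.
apply: eq_edge_sum => k l _.
by rewrite mxE sqrtrM ?sqr_ge0 // sqrtr_sqr ger0_norm // mulrA.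
Qed.

Lemma material_eq0 kappa :
  conductances N kappa -> material N kappa = 0 -> kappa = 0.
Proof.
move=> ck m0; apply/matrixP => k l; rewrite mxE.
case: (ck) => symk _ offk.
case: (boolP (edge N k l)) => [ekl|/offk //].
apply/eqP; rewrite eq_le conductances_ge0 // andbT -sqrtr_eq0.
have : Num.sqrt (kappa k l) * weight N k l = 0.
  (* Weights are symmetric only on edges, so the summand is cut off elsewhere to become symmetric
     everywhere. *)
  pose G i j := if edge N i j then Num.sqrt (kappa i j) * weight N i j else 0.
  have <- : G k l = Num.sqrt (kappa k l) * weight N k l by rewrite /G ekl.
  apply: (@edge_sum_eq0 _ _ N) => //.
  - move=> i j; rewrite /G (edge_sym N j i); case: ifP => // eij.
    by rewrite symk weight_sym.
  - move=> i j eij; rewrite /G eij.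
    by rewrite mulr_ge0 ?sqrtr_ge0 // ltW ?weight_gt0.
  - by rewrite -m0; apply: eq_edge_sum => i j eij; rewrite /G eij.
move/eqP; rewrite mulf_eq0 => /orP[//|].
by rewrite gt_eqF // weight_gt0.
Qed.

(** Pairing the divergence of the gradient flow of [w] with [w] gives zero; by parts this is a sum
    of the nonnegative terms [(w k - w l) ^+ 2 * kappa k l]. *)
Lemma energy_eq0 kappa (w : 'I_V -> R) :
  conductances N kappa ->
  (forall k, w k = 0 \/ \sum_l (w k - w l) * kappa k l = 0) ->
  forall k l, (w k - w l) * kappa k l = 0.
Proof.
move=> ck harm k l; case: (ck) => symk k0 offk.
case: (boolP (edge N k l)) => [ekl|/offk ->]; last by rewrite mulr0.
pose D : 'M[R]_V := \matrix_(i, j) ((w i - w j) * kappa i j).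
have D0 : forall i j, edge N i j -> (w i - w j) * D i j = 0.
  apply: (@edge_sum_eq0 _ _ N).
  - by move=> i j; rewrite !mxE (symk j i); ring.
  - move=> i j eij; rewrite !mxE mulrA -expr2.
    by rewrite mulr_ge0 ?sqr_ge0 ?k0.
  - rewrite edge_sum_by_parts.
    + apply: big1 => i _; under eq_bigr do rewrite mxE.
      by case: (harm i) => ->; rewrite ?mul0r ?mulr0.
    + by move=> i j; rewrite !mxE (symk j i); ring.
    + by move=> i j /offk kij; rewrite mxE kij mulr0.
move/eqP: (D0 k l ekl); rewrite mxE mulf_eq0 => /orP[/eqP ->|/eqP //].
by rewrite mul0r.
Qed.

(** The difference of the two potentials vanishes on the pressure vertices and is harmonic
    elsewhere, so it has no energy. *)
Lemma kirchhoff_flow_uniq kappa Q Q' :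
  conductances N kappa ->
  kirchhoff_flow N B kappa Q -> kirchhoff_flow N B kappa Q' -> Q = Q'.
Proof.
move=> ck [p [pP pF pQ]] [p' [pP' pF' pQ']].
have offk k l : ~~ edge N k l -> kappa k l = 0 by case: ck => _ _; apply.
have H : forall k l, ((p k - p' k) - (p l - p' l)) * kappa k l = 0.
  apply: (energy_eq0 ck (w := fun k => p k - p' k)) => k.
  case: (boolP (k \in pressure_set B)) => kP; first by left; rewrite pP ?pP' ?subrr.
  right; have := congr2 (fun x y => x - y) (pF k kP) (pF' k kP).
  rewrite subrr !sum_edge => [diff0|l /offk ->|l /offk ->]; rewrite ?mulr0 //.
  by rewrite -[RHS]diff0 -sumrB; apply: eq_bigr => l _; ring.
apply/matrixP => k l; rewrite pQ pQ'; apply/eqP; rewrite -subr_eq0 -(H k l).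
by apply/eqP; ring.
Qed.

Lemma kirchhoff_feasible kappa Q :
  conductances N kappa -> kirchhoff_flow N B kappa Q -> feasible_flow kappa Q.
Proof.
case=> symk k0 offk [p [pP pF pQ]]; split.
- by move=> k l; rewrite !pQ (symk l k); ring.
- move=> k kP; rewrite -pF // (sum_edge (N := N)) => [|l /offk ->]; last by rewrite mulr0.
  by apply: eq_bigr => l _; rewrite pQ.
- by move=> k l k_eq0; rewrite pQ k_eq0 mulr0.
Qed.

(* Fredholm alternative: a vector annihilated by the system matrix is constant
   along channels and vanishes on the pressure vertices, so pairing it with the
   right-hand side is a summation by parts against the given feasible flow. *)
Lemma kirchhoff_flow_exists kappa Q :
  conductances N kappa -> feasible_flow kappa Q ->
  exists Q', kirchhoff_flow N B kappa Q'.
Proof.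
move=> ck [antiQ divQ suppQ]; case: (ck) => symk k0 offk.
pose P := pressure_set B.
(* Column [k] encodes the equation at vertex [k], with the pressures as a row vector on the left. *)
pose A : 'M[R]_V := \matrix_(j, k)
  if k \in P then (j == k)%:R
  else (j == k)%:R * \sum_l kappa k l - kappa k j.
pose c : 'rV[R]_V := \row_k if k \in P then pbar B k else inflow B k.
have cA : (c <= A)%MS.
  rewrite submxE; apply/eqP/matrixP => i0 j0; rewrite !mxE.
  pose v := fun k => cokermx A k j0.
  have Av j : \sum_k A j k * v k = 0.
    have /matrixP/(_ j j0) := mulmx_coker A.
    by rewrite !mxE.
  (* In [A v = 0], the rows outside [P] say that [w] is harmonic there, and the rows in [P] express
     [v] through [w]. *)
  pose w k := if k \in P then 0 else v k.
  have Avw j : (if j \in P then v j else w j * \sum_l kappa j l)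
               - \sum_l kappa j l * w l = 0.
    rewrite -[RHS](Av j) [X in _ - X](bigD1 j) //= [in RHS](bigD1 j) //= !mxE eqxx.
    rewrite opprD addrA; congr (_ + _).
      by rewrite /w; case: (j \in P); rewrite ?mul1r; ring.
    rewrite -sumrN; apply: eq_bigr => l ne_lj.
    by rewrite !mxE /w eq_sym (negPf ne_lj) symk; case: (l \in P); rewrite ?mul0r; ring.
  have w_flat : forall k l, (w k - w l) * kappa k l = 0.
    apply: (energy_eq0 ck) => k; have := Avw k; rewrite {1}/w.
    case: ifP => [kP _|kP diff0]; first by left; rewrite /w kP.
    right; rewrite -[RHS]diff0 mulr_sumr -sumrB; apply: eq_bigr => l _.
    by rewrite /w kP; ring.
  have vP k : k \in P -> v k = 0.
    move=> kP; move/eqP: (Avw k); rewrite kP subr_eq0 => /eqP ->.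
    apply: big1 => l _; have := w_flat k l.
    by rewrite {1}/w kP sub0r mulNr => /eqP; rewrite oppr_eq0 mulrC => /eqP.
  transitivity (\sum_k w k * \sum_l Q k l).
    apply: eq_bigr => k _; rewrite mxE -/(v k) /w.
    case: ifPn => [kP|kP]; first by rewrite vP // mulr0 mul0r.
    by rewrite divQ // mulrC.
  rewrite -(edge_sum_by_parts (N := N)) //; last by move=> k l /offk /suppQ.
  apply: big1 => k _; apply: big1 => l _.
  move/eqP: (w_flat k l); rewrite mulf_eq0 => /orP[/eqP ->|/eqP /suppQ ->].
    by rewrite mul0r.
  by rewrite mulr0.
case/submxP: cA => x xA; pose p k := x 0 k.
have pA k : \sum_j p j * A j k = if k \in P then pbar B k else inflow B k.
  by move/matrixP/(_ 0 k): xA; rewrite !mxE => ->.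
have delta_sum k (b : R) : \sum_j p j * ((j == k)%:R * b) = p k * b.
  rewrite (bigD1 k) //= eqxx mul1r big1 ?addr0 // => j /negPf ->.
  by rewrite mul0r mulr0.
exists (\matrix_(k, l) ((p k - p l) * kappa k l)), p; split.
- move=> k kP; have := pA k; rewrite kP => <-.
  rewrite -[LHS]mulr1 -delta_sum; apply: eq_bigr => j _.
  by rewrite mxE kP mulr1.
- move=> k kP; have := pA k; rewrite (negPf kP) => <-.
  rewrite sum_edge => [|l /offk ->]; last by rewrite mulr0.
  transitivity (p k * \sum_l kappa k l - \sum_l p l * kappa k l).
    by rewrite mulr_sumr -sumrB; apply: eq_bigr => l _; ring.
  rewrite -delta_sum -sumrB; apply: eq_bigr => l _.
  by rewrite mxE (negPf kP); ring.
- by move=> k l; rewrite mxE.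
Qed.

Lemma feasible_physical kappa Q :
  conductances N kappa -> feasible_flow kappa Q -> physical N B kappa.
Proof.
move=> ck /(kirchhoff_flow_exists ck)[Q' kQ']; split=> //.
by exists Q'; split=> // Q'' /(kirchhoff_flow_uniq ck kQ').
Qed.

(* Thomson's principle. *)
Lemma kirchhoff_flow_min kappa Q Q' :
  conductances N kappa -> kirchhoff_flow N B kappa Q ->
  feasible_flow kappa Q' ->
  complementary_dissipation N B kappa Q <=
    complementary_dissipation N B kappa Q'.
Proof.
move=> ck kQ [antiQ' divQ' suppQ'].
have [antiQ divQ suppQ] := kirchhoff_feasible ck kQ.
case: (ck) => symk k0 offk; case: kQ => p [pP _ pQ].
have antiD k l : (Q' - Q) k l = - (Q' - Q) l k.
  by rewrite !mxE (antiQ k) (antiQ' k); ring.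
have offD k l : ~~ edge N k l -> (Q' - Q) k l = 0.
  by move=> /offk kkl; rewrite !mxE suppQ // suppQ' // subrr.
have divE (k : 'I_V) : \sum_(l < V | edge N k l) Q' k l =
   \sum_(l < V | edge N k l) Q k l + \sum_l (Q' - Q) k l.
  rewrite !sum_edge => [|l /offk /suppQ //|l /offk /suppQ' //].
  by rewrite -big_split; apply: eq_bigr => l _; rewrite !mxE /=; ring.
rewrite !complementary_dissipationE -subr_ge0.
have -> : dissipation kappa Q' - boundary_work Q' -
   (dissipation kappa Q - boundary_work Q) = dissipation kappa (Q' - Q).
  (* Expand the square around [Q]; in the cross term [Q k l / kappa k l] is the pressure drop. By
     parts, that term is the change of boundary work, since [Q' - Q] has no divergence off the
     pressure vertices. *)
  have -> : dissipation kappa Q' = dissipation kappa (Q' - Q) +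
     (2 * edge_sum N (fun k l => (p k - p l) * (Q' - Q) k l)
      + dissipation kappa Q).
    rewrite -edge_sumZ -!edge_sumD; apply: eq_edge_sum => k l _.
    rewrite !mxE; case: (eqVneq (kappa k l) 0) => [kkl|kkl].
      by rewrite suppQ // suppQ' // subrr expr0n /=; ring.
    by rewrite pQ; field.
  have -> : boundary_work Q' = boundary_work Q +
     2 * edge_sum N (fun k l => (p k - p l) * (Q' - Q) k l).
    rewrite edge_sum_by_parts // /boundary_work -mulrDr; congr (2 * _).
    under eq_bigr do rewrite divE mulrDr.
    rewrite big_split; congr (_ + _) => /=; rewrite big_mkcond.
    apply: eq_bigr => k _; case: ifPn => kP; first by rewrite pP.
    under eq_bigr do rewrite !mxE.
    by rewrite sumrB divQ // divQ' // subrr mulr0.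
  ring.
exact: dissipation_ge0.
Qed.

End Flows.

(** * Deforming a minimizer along circulations *)

Section Circulations.
Variables (R : realType) (V : nat).
Variables (N : prior_network R V) (B : boundary R V).
Variables (K : R) (kappa Q : 'M[R]_V).
Hypothesis (K_gt0 : 0 < K) (minQ : global_minimizer N B K kappa Q).
Implicit Types sigma : 'M[R]_V.

(* Minimality among Kirchhoff flows extends, by Thomson's principle, to all
   feasible flows; rescaling [kappa'] to the amount [K] gives the factor. *)
Lemma minimizer_le kappa' Q' :
  conductances N kappa' -> feasible_flow B kappa' Q' ->
  complementary_dissipation N B kappa Q <=
    (material N kappa' / K) ^+ 2 * dissipation N kappa' Q'
    - boundary_work N B Q'.
Proof.
case: minQ => -[ck _] matK kQ leQ ck' feasQ'.
have le_feas k' : conductances N k' -> material N k' = K ->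
    feasible_flow B k' Q' ->
    complementary_dissipation N B kappa Q <=
      complementary_dissipation N B k' Q'.
  move=> cond_k' mk' feas.
  have phys := feasible_physical cond_k' feas.
  have [Q'' kQ''] := kirchhoff_flow_exists cond_k' feas.
  exact: le_trans (leQ _ _ phys mk' kQ'') (kirchhoff_flow_min cond_k' kQ'' feas).
(* A network without material cannot be rescaled to [K], but it only carries the zero flow, which is
   then feasible for [kappa] itself. *)
case: (eqVneq (material N kappa') 0) => [m0|m_neq0].
  have k'0 := material_eq0 ck' m0.
  case: feasQ' => antiQ' divQ' suppQ'.
  have Q'0 k l : Q' k l = 0 by apply: suppQ'; rewrite k'0 mxE.
  apply: le_trans (le_feas kappa ck matK _) _; first by split.
  rewrite complementary_dissipationE lerD2r m0 mul0r expr0n mul0r.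
  rewrite [leLHS](_ : _ = 0) //; apply: big1 => k _; apply: big1 => l _.
  by rewrite Q'0 expr0n mul0r.
have m_gt0 : 0 < material N kappa' by rewrite lt_def m_neq0 material_ge0.
(* Scaling conductances by [c ^+ 2] multiplies the material by [c] and divides the dissipation by
   [c ^+ 2]. *)
pose c := K / material N kappa'.
have c_gt0 : 0 < c by rewrite divr_gt0.
have c2_neq0 : c ^+ 2 != 0 by rewrite expf_neq0 // gt_eqF.
have -> : (material N kappa' / K) ^+ 2 * dissipation N kappa' Q' =
    dissipation N (c ^+ 2 *: kappa') Q'.
  rewrite -edge_sumZ; apply: eq_edge_sum => k l _; rewrite mxE invfM -exprVn.
  by rewrite invf_div; ring.
apply: le_feas.
- case: ck' => symk k0 offk; split=> [k l|k l ekl|k l /offk kkl].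
  + by rewrite !mxE symk.
  + by rewrite mxE mulr_ge0 ?sqr_ge0 ?k0.
  + by rewrite mxE kkl mulr0.
- by rewrite materialZ ?ltW // /c divfK.
- case: feasQ' => antiQ' divQ' suppQ'; split=> // k l /eqP.
  by rewrite mxE mulf_eq0 (negPf c2_neq0) => /eqP /suppQ'.
Qed.

Let ck : conductances N kappa. Proof. by case: minQ => -[]. Qed.

Let kappa_sym k l : kappa k l = kappa l k. Proof. by case: ck. Qed.

Let feasQ : feasible_flow B kappa Q.
Proof. by case: minQ => _ _ /(kirchhoff_feasible ck). Qed.

Let Q_anti k l : Q k l = - Q l k. Proof. by case: feasQ. Qed.

Let Q_supp k l : kappa k l = 0 -> Q k l = 0. Proof. by case: feasQ => _ _; apply. Qed.

Lemma channelE k l : channel N kappa k l = (kappa k l != 0).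
Proof.
case: ck => _ k0 offk; rewrite /channel /=; case: (boolP (edge N k l)) => [ekl|/offk ->].
  by rewrite lt_def k0 // andbT.
by rewrite ltxx eqxx.
Qed.

Let kappa_edge k l : kappa k l != 0 -> edge N k l.
Proof. by rewrite -channelE => /andP[]. Qed.

Let kappa_ge0 k l : 0 <= kappa k l. Proof. exact: conductances_ge0 ck. Qed.

Let kappa_gt0 k l : kappa k l != 0 -> 0 < kappa k l.
Proof. by move=> kkl; rewrite lt_def kkl kappa_ge0. Qed.

Let sqrt_weight_ge0 k l : edge N k l -> 0 <= Num.sqrt (kappa k l) * weight N k l.
Proof. by move=> ekl; rewrite mulr_ge0 ?sqrtr_ge0 // ltW ?weight_gt0. Qed.

Let sqrt_weight_gt0 k l :
  kappa k l != 0 -> 0 < Num.sqrt (kappa k l) * weight N k l.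
Proof.
move=> kkl; rewrite mulr_gt0 ?sqrtr_gt0 ?kappa_gt0 //.
by rewrite weight_gt0 // kappa_edge.
Qed.

(* Shifting the material of the flowless channels to the others would strictly
   decrease the dissipation. *)
Lemma minimizer_flow_neq0 :
  Q != 0 -> forall k l, kappa k l != 0 -> Q k l != 0.
Proof.
move=> Q_neq0 k l kkl; apply/negP => /eqP Qkl.
pose kappa' : 'M[R]_V := \matrix_(i, j) if Q i j == 0 then 0 else kappa i j.
have Q_eq0C i j : (Q i j == 0) = (Q j i == 0) by rewrite Q_anti oppr_eq0.
have k'P i j : edge N i j ->
    Num.sqrt (kappa i j) * weight N i j = Num.sqrt (kappa' i j) * weight N i j
    + (if Q i j == 0 then Num.sqrt (kappa i j) * weight N i j else 0).
  by move=> _; rewrite mxE; case: ifP; rewrite ?sqrtr0 ?mul0r ?add0r ?addr0.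
have ck' : conductances N kappa'.
  split=> [i j|i j _|i j eij]; rewrite !mxE.
  - by rewrite Q_eq0C kappa_sym.
  - by case: ifP.
  - by case: ck => _ _ ->; rewrite ?if_same.
have feas' : feasible_flow B kappa' Q.
  case: feasQ => _ divQ _; split=> // i j; rewrite mxE.
  by case: eqP => // _ /Q_supp.
have lt_m : material N kappa' < K.
  case: minQ => _ <- _ _; rewrite /material -/(edge_sum N _) -/(edge_sum N _).
  rewrite [ltRHS](eq_edge_sum k'P) edge_sumD ltrDl.
  apply: (@edge_sum_gt0 _ _ _ _ k l).
  - move=> i j; rewrite Q_eq0C; case: ifP => // _; rewrite kappa_sym.
    case: (boolP (edge N i j)) => [/weight_sym -> //|eij].
    by rewrite kappa_sym; case: ck => _ _ ->; rewrite ?sqrtr0 ?mul0r.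
  - by move=> i j eij; case: ifP => // _; apply: sqrt_weight_ge0.
  - exact: kappa_edge.
  - by rewrite Qkl eqxx sqrt_weight_gt0.
have D_gt0 : 0 < dissipation N kappa Q.
  have [[i j] /= Qij] : exists ij : 'I_V * 'I_V, Q ij.1 ij.2 != 0.
    apply/existsP; apply: contraR Q_neq0 => /existsPn Q0.
    by apply/eqP/matrixP => i j; rewrite mxE; apply/eqP/negbNE/(Q0 (i, j)).
  have kij : kappa i j != 0 by apply: contraNneq Qij => /Q_supp ->.
  apply: (@edge_sum_gt0 _ _ _ _ i j).
  - by move=> a b; rewrite kappa_sym (Q_anti a) sqrrN.
  - by move=> a b _; rewrite divr_ge0 ?sqr_ge0.
  - exact: kappa_edge.
  - by rewrite divr_gt0 ?kappa_gt0 // exprn_even_gt0.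
have := minimizer_le ck' feas'; rewrite complementary_dissipationE lerD2r.
have -> : dissipation N kappa' Q = dissipation N kappa Q.
  apply: eq_edge_sum => i j _; rewrite mxE; case: eqP => // ->.
  by rewrite expr0n !mul0r.
apply/negP; rewrite -ltNge -[ltRHS]mul1r ltr_pM2r //.
rewrite expr_lt1 // ?divr_ge0 ?material_ge0 ?(ltW K_gt0) //.
by rewrite ltr_pdivrMr // mul1r.
Qed.

(** The divergence vanishes at pressure vertices too, so adding multiples of [sigma] to [Q] keeps
    the boundary work. *)
Definition circulation sigma : Prop :=
  [/\ forall k l, sigma k l = - sigma l k,
      forall k, \sum_l sigma k l = 0
    & forall k l, kappa k l = 0 -> sigma k l = 0].

(* First-order change of the material when [Q] is replaced by
   [Q + t *: sigma] and [kappa] by [kappa * (1 + t * sigma / Q) ^+ 2]. *)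
Definition material_slope sigma : R :=
  edge_sum N (fun k l =>
    sigma k l / Q k l * (Num.sqrt (kappa k l) * weight N k l)).

(* The deformation described above preserves the dissipation of each channel
   until the first channel vanishes, whose dissipation is then saved. *)
Lemma minimizer_circulation_descent sigma :
  Q != 0 -> circulation sigma -> material_slope sigma <= 0 -> sigma = 0.
Proof.
move=> Q_neq0 [anti_s div_s supp_s] slope_le0.
have Qk := minimizer_flow_neq0 Q_neq0.
pose x i j := sigma i j / Q i j.
have x_sym i j : x i j = x j i.
  by rewrite /x anti_s (Q_anti i) invrN mulrNN.
apply/eqP/negPn/negP => s_neq0.
have [[i0 j0] /= s_ij0] : exists ij : 'I_V * 'I_V, sigma ij.1 ij.2 != 0.
  apply/existsP; apply: contraR s_neq0 => /existsPn s0.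
  by apply/eqP/matrixP => i j; rewrite mxE; apply/eqP/negbNE/(s0 (i, j)).
have supp_s' i j : sigma i j != 0 -> kappa i j != 0.
  by apply: contraNneq => /supp_s ->.
(* If the least ratio were nonnegative, all terms of the slope would be, and the one at [(i0, j0)]
   would be positive. *)
have [[a b] /= x_lt0 x_min] : exists2 ab : 'I_V * 'I_V,
    x ab.1 ab.2 < 0 & forall i j, x ab.1 ab.2 <= x i j.
  case: (@arg_minP _ _ _ (i0, j0) predT (fun ij => x ij.1 ij.2)) => // ab _ ab_min.
  exists ab => [|i j]; last exact: (ab_min (i, j)).
  rewrite ltNge; apply/negP => x_ge0.
  have {ab_min}x_ge0 i j : 0 <= x i j by apply: le_trans x_ge0 (ab_min (i, j) _).
  move: slope_le0; apply/negP; rewrite -ltNge.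
  have kij0 := supp_s' _ _ s_ij0.
  pose G i j := if edge N i j then
    x i j * (Num.sqrt (kappa i j) * weight N i j) else 0.
  rewrite (_ : material_slope sigma = edge_sum N G); last first.
    by apply: eq_edge_sum => i j eij; rewrite /G eij.
  apply: (@edge_sum_gt0 _ _ _ _ i0 j0).
  - move=> i j; rewrite /G edge_sym; case: ifP => // eij.
    by rewrite x_sym kappa_sym (weight_sym eij).
  - by move=> i j eij; rewrite /G eij mulr_ge0 ?sqrt_weight_ge0.
  - exact: kappa_edge.
  - rewrite /G kappa_edge // mulr_gt0 ?sqrt_weight_gt0 //.
    by rewrite lt_def x_ge0 andbT mulf_neq0 // invr_eq0 Qk.
(* The first positive time at which a factor [1 + t * x i j] vanishes; all the others are still
   nonnegative. *)
pose t := - (x a b)^-1.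
have t_gt0 : 0 < t by rewrite oppr_gt0 invr_lt0.
pose y i j := 1 + t * x i j.
have yab : y a b = 0 by rewrite /y /t mulNr mulVf ?subrr // lt_eqF.
have y_ge0 i j : 0 <= y i j.
  by rewrite -yab lerD2l ler_pM2l.
have y_sym i j : y i j = y j i by rewrite /y x_sym.
have sab : sigma a b != 0.
  by apply: contraTneq x_lt0 => s0; rewrite /x s0 mul0r ltxx.
have kab := supp_s' _ _ sab.
pose Q' := Q + t *: sigma.
pose kappa' : 'M[R]_V := \matrix_(i, j) (kappa i j * y i j ^+ 2).
have Q'E i j : Q' i j = Q i j * y i j.
  rewrite !mxE /y /x; case: (eqVneq (kappa i j) 0) => [kij|/Qk Qij].
    by rewrite Q_supp // supp_s // mulr0 !mul0r addr0.
  by field.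
have ck' : conductances N kappa'.
  split=> [i j|i j _|i j eij]; rewrite !mxE.
  - by rewrite kappa_sym y_sym.
  - by rewrite mulr_ge0 ?sqr_ge0.
  - by case: ck => _ _ ->; rewrite ?mul0r.
have feas' : feasible_flow B kappa' Q'.
  case: feasQ => _ divQ _; split=> [i j|i iP|i j /eqP].
  - by rewrite !Q'E Q_anti y_sym mulNr.
  - under eq_bigr do rewrite !mxE.
    by rewrite big_split /= -mulr_sumr div_s mulr0 addr0 divQ.
  - rewrite mxE mulf_eq0 sqrf_eq0 Q'E => /orP[/eqP/Q_supp|/eqP] ->.
      by rewrite mul0r.
    by rewrite mulr0.
have workE : boundary_work N B Q' = boundary_work N B Q.
  congr (2 * _); apply: eq_bigr => i _; congr (_ * _).
  have offk j : ~~ edge N i j -> kappa i j = 0 by case: ck => _ _; apply.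
  rewrite !sum_edge => [|j /offk /Q_supp //|j /offk kij].
    under eq_bigr do rewrite !mxE.
    by rewrite big_split /= -mulr_sumr div_s mulr0 addr0.
  by rewrite Q'E Q_supp ?mul0r.
have le_m : material N kappa' <= K.
  (* As [y i j >= 0], the square root of [y i j ^+ 2] is [y i j], which is affine in [t]. *)
  have -> : material N kappa' = K + t * material_slope sigma.
    case: minQ => _ <- _ _; rewrite -edge_sumZ -edge_sumD.
    apply: eq_edge_sum => i j _; rewrite mxE sqrtrM // sqrtr_sqr ger0_norm //.
    by rewrite /y /x; ring.
  by rewrite gerDl pmulr_rle0.
have lt_D : dissipation N kappa' Q' < dissipation N kappa Q.
  (* The saving is exactly the old dissipation of the channels with [y i j = 0], among them the edge
     [(a, b)]. *)
  rewrite [ltRHS](_ : _ = dissipation N kappa' Q' + edge_sum N (fun i j =>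
      if y i j == 0 then Q i j ^+ 2 / kappa i j else 0)).
    rewrite ltrDl; apply: (@edge_sum_gt0 _ _ _ _ a b).
    - by move=> i j; rewrite kappa_sym (Q_anti i) sqrrN y_sym.
    - by move=> i j _; case: ifP => // _; rewrite divr_ge0 ?sqr_ge0.
    - exact: kappa_edge.
    - by rewrite yab eqxx divr_gt0 ?kappa_gt0 // exprn_even_gt0 // Qk.
  rewrite -edge_sumD; apply: eq_edge_sum => i j _; rewrite Q'E mxE.
  case: eqVneq => [->|yij]; first by rewrite mulr0 expr0n mul0r add0r.
  case: (eqVneq (kappa i j) 0) => [kij|kij].
    by rewrite kij Q_supp // !(mul0r, expr0n, addr0).
  by field; apply/andP.
have := minimizer_le ck' feas'.
rewrite complementary_dissipationE workE lerD2r; apply/negP; rewrite -ltNge.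
apply: le_lt_trans lt_D; rewrite ler_piMl ?dissipation_ge0 //.
rewrite expr_le1 // ?divr_ge0 ?material_ge0 ?(ltW K_gt0) //.
by rewrite ler_pdivrMr // mul1r.
Qed.

(** The slope is odd in [sigma], so the descent applies to [sigma] or to its opposite. *)
Lemma minimizer_circulation_eq0 sigma : Q != 0 -> circulation sigma -> sigma = 0.
Proof.
move=> Q_neq0 circ_s.
case: (lerP (material_slope sigma) 0) => [|/ltW slope_ge0].
  exact: minimizer_circulation_descent.
apply/eqP; rewrite -oppr_eq0; apply/eqP/minimizer_circulation_descent => //.
  case: circ_s => anti_s div_s supp_s; split=> [k l|k|k l kkl].
  - by rewrite !mxE anti_s.
  - by under eq_bigr do rewrite mxE; rewrite sumrN div_s oppr0.
  - by rewrite mxE supp_s // oppr0.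
rewrite (_ : material_slope _ = - material_slope sigma) ?oppr_le0 //.
rewrite -[RHS]mulN1r -edge_sumZ; apply: eq_edge_sum => k l _.
by rewrite mxE; ring.
Qed.

End Circulations.

(** * Unit flows along paths *)

Section PathFlows.
Variables (R : realType) (V : nat).

(** The unit flow sent from [k] along [s], antisymmetric by construction. *)
Fixpoint path_flow (k : 'I_V) (s : seq 'I_V) : 'M[R]_V :=
  if s is a :: s' then delta_mx k a - delta_mx a k + path_flow a s' else 0.

Lemma path_flow_anti k s x y : path_flow k s x y = - path_flow k s y x.
Proof.
elim: s k => [|a s IHs] k; rewrite /= !mxE ?oppr0 // IHs !(andbC (_ == k)).
by ring.
Qed.

Lemma path_flow_div k s x :
  \sum_y path_flow k s x y = (x == k)%:R - (x == last k s)%:R.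
Proof.
elim: s k => [|a s IHs] k /=.
  by rewrite subrr big1 // => y _; rewrite mxE.
under eq_bigr do rewrite !mxE.
rewrite big_split sumrB /= IHs.
have sum_delta (b : bool) c : \sum_y (b && (y == c))%:R = b%:R :> R.
  case: b; last by rewrite big1.
  by rewrite (bigD1 c) //= eqxx big1 ?addr0 // => y /negPf ->.
by rewrite !sum_delta; ring.
Qed.

Lemma path_flow_supp (e : rel 'I_V) k s x y :
  symmetric e -> path e k s -> ~~ e x y -> path_flow k s x y = 0.
Proof.
move=> symE; elim: s k => [|a s IHs] k /=; first by rewrite mxE.
case/andP=> eka /IHs IH exy; rewrite !mxE IH //.
case: (boolP ((x == k) && (y == a))) => [/andP[/eqP xk /eqP ya]|_].
  by rewrite xk ya eka in exy.
case: (boolP ((x == a) && (y == k))) => [/andP[/eqP xa /eqP yk]|_].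
  by rewrite xa yk symE eka in exy.
by rewrite subrr addr0.
Qed.

Lemma path_flow_notin k s x y : x \notin k :: s -> path_flow k s x y = 0.
Proof.
elim: s k => [|a s IHs] k /=; first by rewrite mxE.
rewrite inE negb_or => /andP[/negPf xk xas]; rewrite !mxE IHs // xk.
by move: xas; rewrite inE negb_or => /andP[/negPf -> _]; rewrite subrr addr0.
Qed.

Lemma path_flow_head k a s y :
  uniq [:: k, a & s] -> path_flow k (a :: s) k y = (y == a)%:R.
Proof.
case/andP=> k_as _; rewrite /= !mxE path_flow_notin // eqxx.
by move: k_as; rewrite inE negb_or => /andP[/negPf -> _]; rewrite subr0 addr0.
Qed.

(** A simple path never returns to its start, so row [k] of its flow is the indicator of the next
    vertex; peel off that vertex and recurse. *)
Lemma path_flow_inj k s s' :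
  uniq (k :: s) -> uniq (k :: s') -> path_flow k s = path_flow k s' -> s = s'.
Proof.
elim: s k s' => [|a s IHs] k [|b s'] // u_s u_s' /matrixP eq_flow.
- by move: (eq_flow k b); rewrite path_flow_head // mxE eqxx => /eqP; rewrite eq_sym oner_eq0.
- by move: (eq_flow k a); rewrite path_flow_head // mxE eqxx => /eqP; rewrite oner_eq0.
have eq_ab : a = b.
  have := eq_flow k a; rewrite !path_flow_head // eqxx.
  by case: (eqVneq a b) => // _ /eqP; rewrite oner_eq0.
rewrite -eq_ab in u_s' eq_flow *; congr (_ :: _); apply: (IHs a).
- by case/andP: u_s.
- by case/andP: u_s'.
- by apply/matrixP => x y; have := eq_flow x y; rewrite !mxE => /addrI.
Qed.

End PathFlows.

Theorem theorem3p6 (R : realType) (V : nat)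
    (N : prior_network R V) (B : boundary R V)
    (K : R) (hK : 0 < K) (kappa Q : 'M[R]_V)
    (hmin : global_minimizer N B K kappa Q) :
  (forall k l : 'I_V, connect (channel N kappa) k l ->
     exists! s : seq 'I_V, network_path N kappa k l s)
  \/ (forall k l : 'I_V, edge N k l -> Q k l = 0).
Proof.
case: (eqVneq Q 0) => [->|Q_neq0]; first by right=> k l _; rewrite mxE.
left=> k l /connectP[s path_s ->].
case/shortenP: path_s => s' path_s' uniq_s' _.
exists s'; split=> // s'' [path_s'' last_s'' uniq_s''].
apply: (@path_flow_inj R V k) => //; apply/eqP; rewrite -subr_eq0; apply/eqP.
(* The difference of the unit flows along two paths with the same ends is a circulation, as their
   sources and sinks cancel. *)
apply: (minimizer_circulation_eq0 hK hmin) => //; split=> [x y|x|x y kxy].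
- by rewrite !mxE path_flow_anti (path_flow_anti _ _ s''); ring.
- under eq_bigr do rewrite !mxE.
  by rewrite sumrB !path_flow_div last_s'' subrr.
- have sym_ch : symmetric (channel N kappa).
    by move=> i j; rewrite !(channelE hmin); case: hmin => -[[-> _ _] _].
  by rewrite !mxE !(path_flow_supp _ sym_ch) ?subrr // (channelE hmin) kxy eqxx.
Qed.
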